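(* There exists a universal constant $C_* > 0$ such that the following holds. For every $\eta \in (0,1)$ there exist $\tilde{C}_\eta \geq e$ and $c_\eta > 0$ depending only on $\eta$ such that, for all $p \geq 2$, $n > 0$ and $q_0 \in \Delta_p$ with $q_0(1) \geq \dots \geq q_0(p) \geq 0$ satisfying $$\max_{1 \leq j \leq p-1} q_0^{-\max}(j)\, h^{-1}\left(\frac{\log(ej)}{nq_0^{-\max}(j)}\right) \geq \frac{C_*}{n},$$ and for all $0 < c < c_\eta$, one has $$\mathcal{R}_{\mathcal{PM}}\left(\frac{c\psi}{n}, n, q_0\right) \geq \eta,$$ where $$\psi = nq_0^{-\max}(j^* )\, h^{-1}\left(\frac{\log(\tilde{C}_\eta j^* )}{nq_0^{-\max}(j^* )}\right)\mathbf{1}_{\{m \geq 1\}},$$ $$j^* = \arg\max_{1 \leq j \leq p-1} nq_0^{-\max}(j)\, h^{-1}\left(\frac{\log(ej)}{nq_0^{-\max}(j)}\right), \qquad m = \left\lceil h^{-1}\left(\frac{\log(ej^* )}{nq_0^{-\max}(j^* )}\right)\right\rceil \wedge (j^* - 1).$$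
   Context: $\Delta_p = \{\pi \in [0,1]^p : \sum_{j=1}^p \pi(j) = 1\}$; $\Pi(q_0,\varepsilon) = \{q \in \Delta_p : \|q - q_0\|_\infty \geq \varepsilon\}$ for $\varepsilon \geq 0$, with $\|v\|_\infty = \max_j|v_j|$. $q_0^{-\max} = (q_0(2),\dots,q_0(p)) \in [0,1]^{p-1}$, so $q_0^{-\max}(j) = q_0(j+1)$. The function $h : [-1,\infty) \to \mathbb{R}$ is defined by $h(-1) = 1$ and $h(x) = (1+x)\log(1+x) - x$ for $x > -1$; $h^{-1} : [0,\infty) \to [0,\infty)$ is the inverse of $h$ restricted to $[0,\infty)$. An expression of the form $x\,h^{-1}(a/x)$ is interpreted as $0$ (its limit) when $x = 0$. Here $j^*$ is a maximizer, and $a \wedge b = \min\{a,b\}$. Poissonized multinomial model: for $n > 0$ (not necessarily an integer) and $q \in \Delta_p$, $\mathbf{P}_q$ is the law of $X = (X_1,\dots,X_p)$ with independent $X_j \sim \mathrm{Poisson}(nq(j))$. Its minimax testing risk is $$\mathcal{R}_{\mathcal{PM}}(\varepsilon,n,q_0) = \inf_\varphi\left\{\mathbf{P}_{q_0}\{\varphi = 1\} + \sup_{q \in \Pi(q_0,\varepsilon)} \mathbf{P}_q\{\varphi = 0\}\right\},$$ the infimum being over all measurable $\{0,1\}$-valued functions $\varphi = \varphi(X)$. *)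

(* Defs.v *)
From HB Require Import structures.
From mathcomp Require Import all_boot all_order all_algebra.
From mathcomp Require Import all_classical all_reals all_analysis.

Set Implicit Arguments.
Unset Strict Implicit.
Unset Printing Implicit Defensive.

Import Order.TTheory GRing.Theory Num.Theory.
Import numFieldNormedType.Exports.

Local Open Scope classical_set_scope.
Local Open Scope ring_scope.

(* Since [ln 0 = 0], the formula also gives h (-1) = 1. *)
Definition h {R : realType} (x : R) : R := (1 + x) * ln (1 + x) - x.

Definition hinv {R : realType} : R -> R := pinv (`[0, +oo[%classic : set R) h.

Definition simplex (R : realType) (p : nat) : set 'rV[R]_p :=
  [set q | (forall j, 0 <= q 0 j <= 1) /\ \sum_j q 0 j = 1].

(* On row vectors [`|_|] is the sup norm, see [mx_normrE]. *)
Definition alternatives (R : realType) (p : nat) (q0 : 'rV[R]_p) (eps : R) :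
    set 'rV[R]_p :=
  [set q | simplex q /\ eps <= `|q - q0|].

(* [dropmax q j], for j = 1, ..., p - 1, is the (j+1)-st coordinate of q counting
   from 1, that is, its coordinate of index j counting from 0. *)
Definition dropmax (R : realType) (p : nat) (q : 'rV[R]_p) (j : nat) : R :=
  if insub j is Some i then q 0 i else 0.

Section poisson_model.
Context {R : realType} {p : nat} (n : R) (q : 'rV[R]_p).
Local Open Scope ereal_scope.

(* The atoms are taken from [poisson_prob] and not from [poisson_pmf] because
   only the former is the Dirac mass at 0 when n * q(j) = 0. The second argument of
   [poisson_prob] is not used in its definition. *)
Definition poisson_vector (A : set (p.-tuple nat)) : \bar R :=
  \esum_(x in A) \prod_(j < p) poisson_prob (n * q 0 j)%R 0 [set tnth x j].

Let atom_ge0 (x : p.-tuple nat) :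
  0 <= \prod_(j < p) poisson_prob (n * q 0 j)%R 0 [set tnth x j].
Proof. by apply: prode_ge0 => j _; exact: measure_ge0. Qed.

Let poisson_vector0 : poisson_vector set0 = 0.
Proof. exact: esum_set0. Qed.

Let poisson_vector_ge0 A : 0 <= poisson_vector A.
Proof. by apply: esum_ge0 => x _; exact: atom_ge0. Qed.

Let poisson_vector_sigma_additive : semi_sigma_additive poisson_vector.
Proof.
move=> F mF tF mUF; apply: cvg_toP.
  apply: ereal_nondecreasing_is_cvgn => a b ab.
  by apply: lee_sum_nneg_natr => // k _ _; exact: poisson_vector_ge0.
by rewrite /poisson_vector nneseries_sum_bigcup.
Qed.

HB.instance Definition _ := isMeasure.Build _ _ _ poisson_vector
  poisson_vector0 poisson_vector_ge0 poisson_vector_sigma_additive.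

End poisson_model.

Section poisson_facts.
Local Open Scope ereal_scope.

Lemma esumZl (R : realType) (T : choiceType) (A : set T) (f : T -> \bar R) (r : R) :
  (0 <= r)%R -> (forall x, 0 <= f x) ->
  \esum_(x in A) (r%:E * f x) = r%:E * \esum_(x in A) f x.
Proof.
move=> r0 f0; rewrite /esum -ereal_supZl//; last first.
  by apply/set0P; exists (\sum_(i \in set0) f i); exists set0 => //; exact: fsets_set0.
congr ereal_sup; rewrite image_comp; apply: eq_imagel => X _ /=.
by rewrite ge0_mule_fsumr.
Qed.

Lemma esum_tuple_prod (R : realType) (p : nat) (w : 'I_p -> nat -> \bar R)
    (A : 'I_p -> set nat) :
  (forall j k, 0 <= w j k) ->
  (forall j k, w j k \is a fin_num) ->
  (forall j, \esum_(k in A j) w j k \is a fin_num) ->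
  \esum_(x in [set x : p.-tuple nat | forall j, A j (tnth x j)])
     \prod_(j < p) w j (tnth x j) = \prod_(j < p) \esum_(k in A j) w j k.
Proof.
elim: p w A => [|p IH] w A w0 wf Af.
  rewrite big_ord0 (_ : [set _ | _] = [set [tuple]]); last first.
    by apply/seteqP; split=> x //= _; [rewrite (tuple0 x)|case].
  by rewrite esum_set1 ?big_ord0.
have /= IHp := IH (fun i => w (lift ord0 i)) (fun i => A (lift ord0 i))
  (fun=> w0 _) (fun=> wf _) (fun=> Af _).
rewrite big_ord_recl -IHp.
set Q := \esum_(x in [set x : p.-tuple nat | _]) _.
pose e (z : nat * p.-tuple nat) : p.+1.-tuple nat := [tuple of z.1 :: z.2].
have Qf : Q \is a fin_num by rewrite /Q IHp prode_fin_num.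
have Q0 : 0 <= Q by apply: esum_ge0 => x _; exact: prode_ge0.
rewrite (@reindex_esum _ _ _ (A ord0 `*`` fun=> [set x : p.-tuple nat |
   forall j, A (lift ord0 j) (tnth x j)]) _ e); last first.
  split.
  - move=> [k x] /= [Ak Ax] j; case: (unliftP ord0 j) => [i ->|->].
      by rewrite tnthS.
    by rewrite tnth0.
  - by move=> [k x] [l y] _ _ [-> /val_inj ->].
  - move=> x /= Ax; exists (thead x, [tuple of behead x]) => /=; last first.
      by rewrite /e /= -tuple_eta.
    split; first exact: Ax.
    by move=> j; rewrite (tuple_eta x) in Ax; have := Ax (lift ord0 j); rewrite tnthS.
under eq_esum => z _.
  rewrite big_ord_recl tnth0.
  under eq_bigr do rewrite tnthS.
  over.
rewrite -(@esum_esum _ _ _ _ _ (fun k x => w ord0 k * \prod_(i < p) w (lift ord0 i) (tnth x i))); last first.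
  by move=> k x _ _; rewrite mule_ge0// prode_ge0.
transitivity (\esum_(k in A ord0) (Q * w ord0 k)).
  apply: eq_esum => k _; rewrite -[w ord0 k]fineK// esumZl ?fine_ge0//; last first.
    by move=> x; apply: prode_ge0.
  by rewrite muleC.
by rewrite -[Q]fineK// esumZl ?fine_ge0// muleC.
Qed.

Lemma poisson_probE (R : realType) (r : R) m A :
  \esum_(k in A) poisson_prob r m [set k] = poisson_prob r m A.
Proof.
rewrite /poisson_prob; case: ifPn => r0.
  by apply: eq_esum => k _; rewrite esum_set1// lee_fin poisson_pmf_ge0.
rewrite esum_mkcond (esumID [set 0%N]); last first.
  by move=> i _; case: ifP => //.
rewrite setTI setTI [X in _ + X]esum1 ?adde0; last first.
  move=> i /= i0; case: ifP => // _; rewrite diracE memNset//=.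
  by move=> /esym.
rewrite esum_set1; last by case: ifP.
have d00 : (0%N \in [set 0%N]) = true by exact: mem_set.
by rewrite !diracE d00; case: ifP.
Qed.

(* Independence of the coordinates, with marginals Poisson (n * q(j)). *)
Lemma poisson_vector_box (R : realType) p (n : R) (q : 'rV[R]_p) (A : 'I_p -> set nat) :
  poisson_vector n q [set x | forall j, A j (tnth x j)] =
  \prod_(j < p) poisson_prob (n * q 0 j)%R 0 (A j).
Proof.
rewrite /poisson_vector (@esum_tuple_prod _ _ (fun j k => poisson_prob (n * q 0 j)%R 0 [set k])).
- by apply: eq_bigr => j _; rewrite poisson_probE.
- by move=> j k; exact: measure_ge0.
- by move=> j k; exact: fin_num_measure.
- by move=> j; rewrite poisson_probE; exact: fin_num_measure.
Qed.

Section poisson_probability.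
Context {R : realType} {p : nat} (n : R) (q : 'rV[R]_p).

Let poisson_vectorT : poisson_vector n q setT = 1.
Proof.
rewrite (_ : setT = [set x : p.-tuple nat | forall j, setT (tnth x j)]); last exact/seteqP.
by rewrite (poisson_vector_box n q (fun=> setT)) big1// => j _; exact: probability_setT.
Qed.

HB.instance Definition _ :=
  @Measure_isProbability.Build _ _ R (poisson_vector n q) poisson_vectorT.

End poisson_probability.

End poisson_facts.

(* If [alternatives q0 eps] is empty, the supremum and hence the risk are -oo, so a
   lower bound on the risk also asserts that there are alternatives. *)
Definition risk (R : realType) (p : nat) (eps n : R) (q0 : 'rV[R]_p) : \bar R :=
  ereal_inf [set (poisson_vector n q0 (phi @^-1` [set true]) +
      ereal_sup [set poisson_vector n q (phi @^-1` [set false])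
                | q in alternatives q0 eps])%E
    | phi in [set: {mfun p.-tuple nat >-> bool}]].

Section critical_radius.
Context {R : realType} {p : nat} (n : R) (q0 : 'rV[R]_p).

(* The convention x * hinv (a / x) = 0 for x = 0 holds since 0 is absorbing. *)
Definition radius (C : R) (j : nat) : R :=
  let x := n * dropmax q0 j in x * hinv (ln (C * j%:R) / x).

Definition is_jstar (j : nat) : Prop :=
  (1 <= j < p)%N /\
  forall i : nat, (1 <= i < p)%N -> radius (expR 1) i <= radius (expR 1) j.

Definition mstar (j : nat) : int :=
  Num.min (Num.ceil (hinv (ln (expR 1 * j%:R) / (n * dropmax q0 j))))
          (j%:Z - 1).

Definition psi (C : R) (j : nat) : R := radius C j * (1 <= mstar j)%R%:R.

End critical_radius.

(* Main.v *)
Require Import Defs.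
From mathcomp Require Import all_boot all_order all_algebra.
From mathcomp Require Import all_classical all_reals all_analysis.
From mathcomp Require Import ring lra.
Import Order.TTheory GRing.Theory Num.Theory.
Import numFieldNormedType.Exports.

(** By the choice of [jstar], which maximizes [radius (expR 1)], the hypothesis on
    the maximum says [lam * M >= 2], where [lam] is the Poisson mean of the cell
    [jstar] counted from 0, [L = ln (expR 1 * jstar%:R)] and [M = hinv (L / lam)].
    The constants are [Cstar = 2] and [Ceta = expR 1], so that [psi = lam * M]
    unless its indicator vanishes; in that case the radius is 0, the null is itself
    an alternative and the risk is at least 1.

    Otherwise let [S] be the set of the cells [0, ..., jstar], all of which have
    Poisson mean at least [lam]. The lower bound compares the null with the mixture,
    over [i] in [S], of the alternatives that add a mass [d = 2 * c * psi] (counted in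
    Poisson means) to the cell [i] and withdraw [d / #|S|] from every cell of [S].
    The total mass being preserved, likelihood ratios are pure monomials in the
    observation, and all their moments are values of the Poisson generating function
    [wesum_monomial]. A test does badly against the mixture as soon as the averaged
    likelihood ratio, possibly truncated, is close to 1 in mean square under the null
    ([bayes_risk_ge], [risk_ge_mixture]).

    Two different indices contribute [expR (d ^+ 2 / (#|S| * lam))] to the second moment
    ([cross_moment_le]), which is close to 1: since [lam * M >= 2] and [lam * h M = L],
    the increment satisfies [ln (1 + M) <= 1 + L / 2] ([ln_critical_le]) and hence
    [lam * M ^+ 2 <= 8 * expR (1 + L)], of the order of [#|S|] ([sqr_critical_le]). The
    diagonal terms are more delicate, because [d ^+ 2 / lam] may be much larger than [L]
    when [M] is large. If [L] is at most a constant [K] depending on [eta], everything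
    is bounded and a small [c] suffices ([risk_ge_plain]). If [L > K], each likelihood
    ratio is truncated at [expR (L / 2)], so that the diagonal contributes at most
    [expR (L / 2) / #|S|], and the mass lost in the truncation is bounded by the moment
    of order [1 + K / L] ([risk_ge_truncated]). That moment is governed by
    [lam * h (2 * c * M) <= 2 * c * L] rather than by [d ^+ 2 / lam]
    ([moment_excess_le_h], [powR_moment_le]), hence is bounded for small [c]. *)

Local Open Scope classical_set_scope.
Local Open Scope ring_scope.

Set Implicit Arguments.
Unset Strict Implicit.

(** * The rate function h and its inverse *)

Section rate_function.
Context {R : realType}.
Implicit Types (x y a t k : R).

Lemma h0 : h 0 = 0 :> R.
Proof. by rewrite /h addr0 ln1 mulr0 subr0. Qed.

Lemma ln_ge_1BV x : 0 < x -> 1 - x^-1 <= ln x.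
Proof.
move=> x0; have xi0 : 0 < x^-1 by rewrite invr_gt0.
have := @le_ln1Dx R (x^-1 - 1); rewrite [1 + _]addrC subrK lnV ?posrE// => H.
have {}H : - ln x <= x^-1 - 1 by apply: H; lra.
lra.
Qed.

(** With [s = sqrt (1 + x)], the bound [ln s >= 1 - s^-1] gives the Hellinger-type
    inequality [h x >= (s - 1) ^+ 2], and [x = (s - 1) * (s + 1)] with
    [s + 1 <= 2 * s]. *)
Lemma sqr_le_h x : 0 <= x -> x ^+ 2 <= 4 * (1 + x) * h x.
Proof.
move=> x0; set s := Num.sqrt (1 + x).
have sE : s ^+ 2 = 1 + x by rewrite sqr_sqrtr//; lra.
have s1 : 1 <= s by rewrite -sqrtr1 ler_wsqrtr//; lra.
have s0 : 0 < s by lra.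
have lns : ln (1 + x) = 2 * ln s by rewrite -sE lnXn// mulr_natl.
have H : (s - 1) ^+ 2 <= h x.
  rewrite /h lns; have := @ln_ge_1BV s s0; set l := ln s => Hl.
  have : s * (s - 1) <= s ^+ 2 * l.
    rewrite expr2 -mulrA ler_pM2l// -(ler_pM2l (_ : 0 < s^-1)) ?invr_gt0//.
    by rewrite mulKf ?gt_eqF// mulrBr mulVf ?gt_eqF// mulr1.
  rewrite sE => H; nra.
apply: le_trans (_ : 4 * (1 + x) * (s - 1) ^+ 2 <= _).
  have -> : x = (s - 1) * (s + 1) by rewrite -subr_sqr sE expr1n; ring.
  rewrite exprMn [leLHS]mulrC ler_wpM2r ?sqr_ge0//.
  have -> : 4 * (1 + (s - 1) * (s + 1)) = (2 * s) ^+ 2 by ring.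
  by rewrite ler_sqr ?nnegrE; lra.
by rewrite ler_wpM2l//; lra.
Qed.

Lemma h_ge0 x : 0 <= x -> 0 <= h x.
Proof.
move=> x0; rewrite -(@pmulr_rge0 _ (4 * (1 + x))); last lra.
apply: le_trans (sqr_ge0 _) (sqr_le_h x0).
Qed.

Lemma xlnx_tangent (u v : R) : 0 < u -> 0 < v ->
  u * ln u + (1 + ln u) * (v - u) <= v * ln v.
Proof.
move=> u0 v0; have := @ln_ge_1BV (v / u) (divr_gt0 v0 u0).
rewrite ln_div ?posrE// invf_div => H.
have : v * (1 - u / v) <= v * (ln v - ln u) by rewrite ler_wpM2l// ltW.
by rewrite mulrBr mulr1 mulrCA divff ?gt_eqF// mulr1 => {}H; lra.
Qed.

(** [h] is convex and vanishes at 0. *)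
Lemma h_scale_le x a : 0 <= x -> 0 <= a <= 1 -> h (a * x) <= a * h x.
Proof.
move=> x0 /andP[a0 a1]; have ax0 : 0 <= a * x by exact: mulr_ge0.
have u0 : 0 < 1 + a * x by lra.
have v0 : 0 < 1 + x by lra.
(* Convexity of u * ln u at [1 + a * x], which lies between [1] and [1 + x]. *)
have H1 := xlnx_tangent u0 (ltr01 : 0 < 1 :> R).
have H2 := xlnx_tangent u0 v0.
rewrite ln1 in H1; rewrite /h.
set u := ln (1 + a * x) in H1 H2 *; set v := ln (1 + x) in H2 *.
have a1' : 0 <= 1 - a by lra.
have {}H1 := ler_wpM2l a1' H1.
have {}H2 := ler_wpM2l a0 H2.
lra.
Qed.

Lemma ln_le_h_div x : 0 < x -> ln (1 + x) <= 1 + h x / x.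
Proof.
move=> x0; rewrite -(ler_pM2l x0) mulrDr mulrCA divff ?gt_eqF// /h.
have : 0 <= ln (1 + x) by apply: ln_ge0; lra.
by set l := ln _; lra.
Qed.

Lemma h_surj : set_surj `[0, +oo[ `[0, +oo[ (@h R).
Proof.
move=> y /=; rewrite in_itv/= andbT => y0.
pose b : R := expR (1 + y).
have b1 : 1 <= b by rewrite -expR0 ler_expR; lra.
have hb : y <= h (b - 1) by rewrite /h [1 + _]addrC subrK expRK; nra.
have [|||c cb hc] := @IVT R h 0 (b - 1) y.
- by lra.
- apply: continuous_in_subspaceT => z; rewrite inE/= in_itv/= => /andP[z0 _].
  have z1 : {for z, continuous (fun z : R => 1 + z)}.
    by apply: cvgD; [exact: cvg_cst|exact: cvg_id].
  apply: cvgB; last exact: cvg_id.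
  apply: cvgM => //; apply: continuous_comp => //.
  by apply: continuous_ln; lra.
- by rewrite h0 ge_min y0 le_max hb orbT.
exists c => //=; move: cb; rewrite !in_itv/= andbT => /andP[]//.
Qed.

Lemma hinvK y : 0 <= y -> h (hinv y) = y.
Proof.
by move=> y0; apply: (surjpK _ h_surj); rewrite inE/= in_itv/= y0.
Qed.

End rate_function.

(** * Moments of a Poisson likelihood ratio *)

(** Multiplied by [l], the quantity [r * r `^ t - 1 - (1 + t) * (r - 1)] is the
    logarithm of the moment of order [1 + t] of the likelihood ratio of
    Poisson([l * r]) against Poisson([l]), under the latter. *)
Section moment_excess.
Context {R : realType}.
Implicit Types (r t k y : R).

(** Concavity of [r |-> r `^ t]: the graph lies below its tangent at 1. *)
Lemma powR_le_affine r t : 0 < r -> 0 <= t <= 1 -> r `^ t <= 1 + t * (r - 1).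
Proof.
move=> r0 /andP[t0 t1]; rewrite /powR gt_eqF//.
rewrite -{2}(lnK (_ : r \in Num.pos)) ?posrE//; set a := ln r; set u := t * a.
have tangent (v : R) : expR u * (1 + (v - u)) <= expR v.
  have -> : expR v = expR u * expR (v - u) by rewrite -expRD addrC subrK.
  by rewrite ler_wpM2l ?expR_ge0// expR_ge1Dx.
have H1 := ler_wpM2l t0 (tangent a).
have t1' : 0 <= 1 - t by lra.
have H2 := ler_wpM2l t1' (tangent 0); rewrite expR0 in H2.
rewrite /u in H1 H2 *; nra.
Qed.

Lemma moment_excess_le_sqr r t : 0 < r -> 0 <= t <= 1 ->
  r * r `^ t - 1 - (1 + t) * (r - 1) <= t * (r - 1) ^+ 2.
Proof.
move=> r0 t01; have := ler_wpM2l (ltW r0) (powR_le_affine r0 t01); lra.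
Qed.

(** For large [y] the quadratic bound [moment_excess_le_sqr] is useless, since [h]
    only grows like [y * ln y]. Linearising [r `^ t] in [t * ln r] costs the factor
    [expR k] and leaves [t * (1 + y) * ln (1 + y)], comparable to [t * h y] as soon
    as [y >= 1]. *)
Lemma moment_excess_le_h y t k : 0 <= y -> 0 <= t <= 1 -> t * ln (1 + y) <= k ->
  (1 + y) * (1 + y) `^ t - 1 - (1 + t) * y <= 9 * expR k * t * h y.
Proof.
move=> y0 t01 tk; have [t0 t1] := andP t01.
have l0 : 0 <= ln (1 + y) by apply: ln_ge0; lra.
have k0 : 0 <= k by apply: le_trans tk; exact: mulr_ge0.
have ek1 : 1 <= expR k by rewrite -expR0 ler_expR.
have hy0 : 0 <= h y by exact: h_ge0.
have th0 : 0 <= t * h y by exact: mulr_ge0.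
have sq := sqr_le_h y0.
have r0 : 0 < 1 + y by lra.
have [y1|y1] := leP y 1.
  have := moment_excess_le_sqr r0 t01; rewrite [1 + y - 1]addrC addKr => H.
  apply: (le_trans H); apply: (@le_trans _ _ (9 * 1 * (t * h y))); last first.
    by rewrite -[leRHS]mulrA ler_wpM2r//; lra.
  apply: (@le_trans _ _ (t * (9 * h y))); last lra.
  by rewrite ler_wpM2l//; nra.
have yh : y <= 8 * h y.
  rewrite -(@ler_pM2l _ y); last lra.
  by rewrite -expr2; apply: (le_trans sq); nra.
have E : (1 + y) * ln (1 + y) <= 9 * h y.
  by have -> : (1 + y) * ln (1 + y) = h y + y by [rewrite /h; ring]; lra.
have pk : (1 + y) `^ t <= expR k by rewrite /powR gt_eqF// ler_expR.
have pe : (1 + y) `^ t - 1 <= expR k * (t * ln (1 + y)).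
  apply: (@le_trans _ _ ((1 + y) `^ t * (t * ln (1 + y)))); last first.
    by rewrite ler_wpM2r// mulr_ge0.
  rewrite /powR gt_eqF//; set a := t * _.
  have := expR_ge1Dx (- a); rewrite expRN => H.
  have e0 := expR_gt0 a.
  have := ler_wpM2l (ltW e0) H; rewrite divff ?gt_eqF//; lra.
have := ler_wpM2l (ltW r0) pe.
have : expR k * t * ((1 + y) * ln (1 + y)) <= expR k * t * (9 * h y).
  by rewrite ler_wpM2l// mulr_ge0// expR_ge0.
nra.
Qed.

End moment_excess.

(** * The truncated second moment method *)

Section weighted_sums.
Context {R : realType} {T : choiceType}.
Context (w : T -> \bar R) (w0 : forall x, (0 <= w x)%E).
Implicit Types (F G : T -> R) (r : R).

(** The expectation of [F] under the distribution with atoms [w]. *)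
Definition wesum (F : T -> R) : \bar R := (\esum_(x in [set: T]) (w x * (F x)%:E))%E.

Let term_ge0 F : (forall x, 0 <= F x) -> forall x, (0 <= w x * (F x)%:E)%E.
Proof. by move=> F0 x; rewrite mule_ge0// lee_fin. Qed.

Lemma wesum_ge0 F : (forall x, 0 <= F x) -> (0 <= wesum F)%E.
Proof. by move=> F0; apply: esum_ge0 => x _; exact: term_ge0. Qed.

Lemma le_wesum F G : (forall x, F x <= G x) -> (wesum F <= wesum G)%E.
Proof. by move=> FG; apply: le_esum => x _; rewrite lee_wpmul2l// lee_fin. Qed.

Lemma wesumD F G : (forall x, 0 <= F x) -> (forall x, 0 <= G x) ->
  wesum (fun x => F x + G x) = (wesum F + wesum G)%E.
Proof.
move=> F0 G0; rewrite /wesum -esumD; last 2 first.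
- by move=> x _; exact: term_ge0.
- by move=> x _; exact: term_ge0.
by apply: eq_esum => x _; rewrite EFinD ge0_muleDr ?lee_fin.
Qed.

Lemma wesumZ r F : 0 <= r -> (forall x, 0 <= F x) ->
  wesum (fun x => r * F x) = (r%:E * wesum F)%E.
Proof.
move=> r0 F0; rewrite /wesum -esumZl//; last exact: term_ge0.
by apply: eq_esum => x _; rewrite EFinM muleCA.
Qed.

Lemma wesum_sum (I : finType) (S : {set I}) (F : I -> T -> R) :
  (forall i x, i \in S -> 0 <= F i x) ->
  wesum (fun x => \sum_(i in S) F i x) = (\sum_(i in S) wesum (F i))%E.
Proof.
move=> F0; rewrite /wesum -esum_sum; last first.
  by move=> x i _ iS; apply: term_ge0 => y; exact: F0.
apply: eq_esum => x _; rewrite -sumEFin ge0_sume_distrr// => i iS.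
by rewrite lee_fin F0.
Qed.

Lemma wesum_indic (A : set T) : wesum \1_A = (\esum_(x in A) w x)%E.
Proof.
rewrite /wesum [RHS]esum_mkcond; apply: eq_esum => x _.
by rewrite indicE; case: ifP => _; rewrite ?mule1 ?mule0.
Qed.

(** Here [wesum \1_A] is the probability of rejecting under the null, [U i] minorizes
    the likelihood ratio of the [i]-th alternative and [s] bounds the masses of the
    [U i] on the acceptance region. With [V] the mean of the [U i], the hypotheses say
    that [V] has mean at least [1 - alpha] and second moment at most [1 + alpha], so
    that [(V - 1) ^+ 2] has mean at most [3 * alpha]: under the null [V] is close to 1,
    and accepting costs about as much under the mixture as rejecting under the null. *)
Lemma bayes_risk_ge (I : finType) (S : {set I}) (U : I -> T -> R)
    (G : I -> I -> R) (alpha b : R) (A : set T) (s : \bar R) :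
  (0 < #|S|)%N -> 0 < b -> wesum (cst 1) = 1%E ->
  (forall i x, i \in S -> 0 <= U i x) ->
  (forall i, i \in S -> ((1 - alpha)%:E <= wesum (U i))%E) ->
  (forall i k, i \in S -> k \in S ->
     (wesum (fun x => U i x * U k x)%R <= (G i k)%:E)%E) ->
  \sum_(i in S) \sum_(k in S) G i k <= (1 + alpha) * #|S|%:R ^+ 2 ->
  (forall i, i \in S -> (wesum (fun x => \1_(~` A) x * U i x)%R <= s)%E) ->
  ((1 - alpha - b / 2 - 3 * alpha / (2 * b))%:E <= wesum \1_A + s)%E.
Proof.
move=> S0 b0 w1 U0 EU EUU GS EA.
have [i0 i0S] : exists i, i \in S by apply/set0Pn; rewrite -card_gt0.
have N0 : 0 < #|S|%:R :> R by rewrite ltr0n.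
have Ni0 : 0 <= #|S|%:R^-1 :> R by rewrite invr_ge0 ltW.
have i1A x : 0 <= \1_(~` A) x * U i0 x :> R by rewrite mulr_ge0 ?U0// indicE.
have s0 : (0 <= s)%E by apply: le_trans (EA _ i0S); exact: wesum_ge0.
have P0 : (0 <= wesum \1_A)%E by apply: wesum_ge0 => x; rewrite indicE.
case: s s0 EA => [s| |]// s0 EA; last by rewrite addey ?leey// gt_eqF// (lt_le_trans _ P0).
pose V x := #|S|%:R^-1 * \sum_(i in S) U i x.
have V0 x : 0 <= V x by rewrite mulr_ge0// sumr_ge0// => i /U0.
have EV : ((1 - alpha)%:E <= wesum V)%E.
  rewrite wesumZ//; last by move=> x; apply: sumr_ge0 => i /U0.
  rewrite wesum_sum//.
  have -> : 1 - alpha = #|S|%:R^-1 * \sum_(i in S) (1 - alpha).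
    by rewrite sumr_const -[X in _ * X]mulr_natl mulKf ?gt_eqF.
  rewrite EFinM lee_wpmul2l ?lee_fin// -sumEFin.
  by apply: lee_sum => i; exact: EU.
have EAV : (wesum (fun x => \1_(~` A) x * V x)%R <= s%:E)%E.
  rewrite (_ : (fun _ => _) = fun x =>
      #|S|%:R^-1 * \sum_(i in S) (\1_(~` A) x * U i x)); last first.
    by apply/funext => x; rewrite mulrCA mulr_sumr.
  have H0 i x : i \in S -> 0 <= \1_(~` A) x * U i x :> R.
    by move=> iS; rewrite mulr_ge0 ?U0// indicE.
  rewrite wesumZ//; last by move=> x; apply: sumr_ge0 => i /H0.
  rewrite wesum_sum//.
  have -> : s = #|S|%:R^-1 * \sum_(i in S) s.
    by rewrite sumr_const -[X in _ * X]mulr_natl mulKf ?gt_eqF.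
  rewrite EFinM lee_wpmul2l ?lee_fin// -sumEFin.
  by apply: lee_sum => i; exact: EA.
have EVV : (wesum (fun x => V x ^+ 2)%R <= (1 + alpha)%:E)%E.
  rewrite (_ : (fun _ => _) = fun x =>
      #|S|%:R^-1 ^+ 2 * \sum_(i in S) \sum_(k in S) U i x * U k x); last first.
    apply/funext => x; rewrite exprMn; congr (_ * _).
    by rewrite expr2 mulr_suml; apply: eq_bigr => i _; rewrite mulr_sumr.
  have H0 i x : i \in S -> 0 <= \sum_(k in S) U i x * U k x.
    by move=> iS; apply: sumr_ge0 => k kS; rewrite mulr_ge0 ?U0.
  rewrite wesumZ ?sqr_ge0//; last by move=> x; apply: sumr_ge0 => i /H0.
  rewrite wesum_sum//.
  apply: (@le_trans _ _ ((#|S|%:R^-1 ^+ 2)%:E * (\sum_(i in S) \sum_(k in S) G i k)%:E)%E).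
    rewrite lee_wpmul2l ?lee_fin ?sqr_ge0// -sumEFin; apply: lee_sum => i iS.
    rewrite wesum_sum; last by move=> k x kS; rewrite mulr_ge0 ?U0.
    by rewrite -sumEFin; apply: lee_sum => k kS; exact: EUU.
  rewrite -EFinM lee_fin exprVn ler_pdivrMl ?exprn_gt0//.
  by rewrite mulrC.
(* The body of [V] must be hidden from the rewrites with [wesumZ] below. *)
move: V V0 EV EAV EVV => V V0 EV EAV EVV.
have b2 : 0 <= (2 * b)^-1 by rewrite invr_ge0; lra.
(* Pointwise this is [V - 1 <= b / 2 + (V - 1) ^+ 2 / (2 * b)] on [A], rearranged so
   that both sides are sums of nonnegative terms. *)
have key : (wesum (fun x => (1 + b^-1) * V x)%R <=
    wesum (fun x => ((\1_A x + \1_(~` A) x * V x) + (b / 2 + (2 * b)^-1) * cst 1 x)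
      + (2 * b)^-1 * V x ^+ 2)%R)%E.
  apply: le_wesum => x; rewrite /= mulr1 -(ler_pM2l (_ : 0 < 2 * b)); last lra.
  have bb : b * b^-1 = 1 by rewrite divff ?gt_eqF.
  have -> : 2 * b * ((1 + b^-1) * V x) = 2 * b * V x + 2 * V x.
    by transitivity (2 * b * V x + 2 * (b * b^-1) * V x); [ring|rewrite bb mulr1].
  have bb2 : 2 * b * (2 * b)^-1 = 1 by rewrite divff// gt_eqF//; lra.
  rewrite mulrDr [2 * b * ((2 * b)^-1 * _)]mulrA bb2 mul1r mulrDr.
  rewrite [2 * b * (b / 2 + _)]mulrDr bb2.
  rewrite !indicE in_setC; case: (x \in A) => /=.
    rewrite mul0r addr0.
    have := sqr_ge0 (V x - 1 - b); lra.
  rewrite mul1r add0r.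
  have := sqr_ge0 (V x - 1); have := sqr_ge0 b; lra.
have i1 x : 0 <= \1_A x :> R by rewrite indicE.
have i2 x : 0 <= \1_(~` A) x * V x :> R by rewrite mulr_ge0// indicE.
have b3 : 0 <= b / 2 + (2 * b)^-1 by rewrite addr_ge0// divr_ge0// ltW.
rewrite wesumZ ?addr_ge0 ?invr_ge0 ?(ltW b0)// in key.
rewrite wesumD in key;
  [|by move=> x; rewrite !addr_ge0//= mulr1|by move=> x; rewrite mulr_ge0// sqr_ge0].
rewrite wesumD in key; [|by move=> x; rewrite addr_ge0|by move=> x; rewrite /= mulr1].
rewrite wesumD// !wesumZ// in key; last by move=> x; exact: sqr_ge0.
rewrite w1 mule1 in key.
have c0 : 0 <= 1 + b^-1 by rewrite addr_ge0// invr_ge0 ltW.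
have {}key := le_trans (lee_wpmul2l (c0 : (0 <= (1 + b^-1)%:E)%E) EV) key.
have {}key : (((1 + b^-1) * (1 - alpha))%R%:E <=
    wesum \1_A + (s + (b / 2 + (2 * b)^-1) + (2 * b)^-1 * (1 + alpha))%:E)%E.
  apply: (le_trans key).
  rewrite [X in (_ <= _ + X)%E]EFinD [X in (_ <= _ + (X + _))%E]EFinD EFinM !addeA.
  apply: leeD; first by rewrite leeD2r// leeD2l.
  by rewrite lee_wpmul2l// lee_fin.
case: (wesum \1_A) P0 key => [P| |] //= _; last by rewrite addye ?leey.
rewrite -!EFinD !lee_fin.
have -> : 3 * alpha / (2 * b) = 3 * alpha * b^-1 / 2 by rewrite invfM; ring.
have -> : (2 * b)^-1 = b^-1 / 2 by rewrite invfM mulrC.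
lra.
Qed.

End weighted_sums.

(** * Vectors of independent Poisson variables *)

Section poisson_tilting.
Context {R : realType}.
Local Open Scope ereal_scope.

(** Exponential tilting: a monomial weight turns Poisson([l]) into a multiple of
    Poisson([l * th]). This is what computes all moments of likelihood ratios, with
    no summation of series. *)
Lemma poisson_prob_tilt (l th : R) k : (0 <= l)%R -> (0 <= th)%R ->
  poisson_prob l 0 [set k] * (th ^+ k)%:E =
  (expR (l * (th - 1)))%:E * poisson_prob (l * th) 0 [set k].
Proof.
rewrite /poisson_prob.
have d0 j : (\d_0%N [set j] : \bar R) = (j == 0%N)%:R%:E.
  rewrite diracE; case: eqP => [->|j0]; first by rewrite mem_set.
  by rewrite memNset// => /esym.
rewrite le_eqVlt => /predU1P[<- _|l0].
  rewrite !mul0r ltxx expR0 !d0 mul1e; case: k => [|k]; first by rewrite mule1.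
  by rewrite mul0e.
rewrite l0 le_eqVlt => /predU1P[<-|th0].
  rewrite mulr0 ltxx d0 esum_set1 ?lee_fin ?poisson_pmf_ge0//.
  rewrite /poisson_pmf l0 -!EFinM; congr EFin; case: k => [|k] /=.
    by rewrite !expr0 fact0 sub0r mulrN1 divr1 mul1r.
  by rewrite expr0n /= !mulr0.
rewrite mulr_gt0// !esum_set1 ?lee_fin ?poisson_pmf_ge0//.
rewrite /poisson_pmf l0 mulr_gt0// -!EFinM; congr EFin.
rewrite exprMn [RHS]mulrC -[RHS]mulrA -expRD.
have -> : (- (l * th) + l * (th - 1) = - l)%R by ring.
ring.
Qed.

Context {p : nat}.

Definition poisson_atom (n : R) (q : 'rV[R]_p) (x : p.-tuple nat) : \bar R :=
  \prod_(j < p) poisson_prob (n * q 0%R j)%R 0 [set tnth x j].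

Definition monomial (th : 'I_p -> R) (x : p.-tuple nat) : R :=
  (\prod_(j < p) th j ^+ tnth x j)%R.

Lemma poisson_atom_ge0 n q x : 0 <= poisson_atom n q x.
Proof. by apply: prode_ge0 => j _; exact: measure_ge0. Qed.

Lemma monomial_ge0 th x : (forall j, 0 <= th j)%R -> (0 <= monomial th x)%R.
Proof. by move=> th0; apply: prodr_ge0 => j _; rewrite exprn_ge0. Qed.

Lemma monomialM th th' x :
  (monomial th x * monomial th' x = monomial (fun j => th j * th' j) x)%R.
Proof. by rewrite /monomial -big_split; apply: eq_bigr => j _; rewrite exprMn. Qed.

Lemma poisson_atom_tilt (n : R) (q : 'rV[R]_p) (th : 'I_p -> R) x :
  (0 <= n)%R -> (forall j, 0 <= q 0%R j)%R -> (forall j, 0 <= th j)%R ->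
  poisson_atom n q x * (monomial th x)%:E =
  (expR (\sum_j n * q 0%R j * (th j - 1))%R)%:E *
    poisson_atom n (\row_j (q 0%R j * th j)%R) x.
Proof.
move=> n0 q0 th0; rewrite /poisson_atom /monomial expR_sum -!prodEFin -!big_split/=.
by apply: eq_bigr => j _; rewrite mxE poisson_prob_tilt ?mulr_ge0// mulrA.
Qed.

(** The probability generating function of a vector of independent Poisson
    variables. *)
Lemma wesum_monomial (n : R) (q : 'rV[R]_p) (th : 'I_p -> R) :
  (0 <= n)%R -> (forall j, 0 <= q 0%R j)%R -> (forall j, 0 <= th j)%R ->
  wesum (poisson_atom n q) (monomial th) =
  (expR (\sum_j n * q 0%R j * (th j - 1))%R)%:E.
Proof.
move=> n0 q0 th0; rewrite /wesum.
under eq_esum do rewrite poisson_atom_tilt//.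
rewrite esumZl ?expR_ge0//; last exact: poisson_atom_ge0.
have /= := @probability_setT _ _ _ (poisson_vector n (\row_j (q 0%R j * th j)%R)).
by rewrite /poisson_vector => ->; rewrite mule1.
Qed.

End poisson_tilting.

(** * Lower bounds on the testing risk *)

Section risk_bounds.
Context {R : realType} {p : nat}.
Implicit Types (n : R) (q : 'rV[R]_p).

Lemma poisson_vector_wesum n q (A : set (p.-tuple nat)) :
  poisson_vector n q A = wesum (poisson_atom n q) \1_A.
Proof. by rewrite wesum_indic. Qed.

Lemma wesum_atom1 n q : wesum (poisson_atom n q) (cst 1) = 1%E.
Proof.
by rewrite -(_ : \1_setT = cst 1) -?poisson_vector_wesum ?probability_setT// indicT.
Qed.

(** At radius 0 the null is one of the alternatives. *)
Lemma risk0_ge1 n q0 : simplex q0 -> (1 <= risk 0 n q0)%E.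
Proof.
move=> sq0; apply: le_ereal_inf_tmp => _ [phi _ <-].
apply: (@le_trans _ _ (poisson_vector n q0 (phi @^-1` [set true]) +
  poisson_vector n q0 (phi @^-1` [set false]))%E); last first.
  by rewrite leeD2l//; apply: ereal_sup_ubound; exists q0.
have ind0 (A : set (p.-tuple nat)) x : 0 <= \1_A x :> R by rewrite indicE.
rewrite !poisson_vector_wesum -wesumD//; last exact: poisson_atom_ge0.
rewrite -(wesum_atom1 n q0); apply: le_wesum => [|x]; first exact: poisson_atom_ge0.
rewrite !indicE; have [tx|fx] := boolP (phi x).
  have -> : x \in phi @^-1` [set true] by rewrite inE.
  by rewrite lerDl.
have -> : x \in phi @^-1` [set false] by rewrite inE; exact/negbTE.
by rewrite lerDr.
Qed.

(** [L i] is the likelihood ratio of the alternative [q i] against [q0]. *)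
Lemma risk_ge_mixture (I : finType) (S : {set I}) n eps q0 (q : I -> 'rV[R]_p)
    (L U : I -> p.-tuple nat -> R) (G : I -> I -> R) (alpha b : R) :
  (0 < #|S|)%N -> 0 < b ->
  (forall i, i \in S -> alternatives q0 eps (q i)) ->
  (forall i x, i \in S ->
     poisson_atom n (q i) x = (poisson_atom n q0 x * (L i x)%:E)%E) ->
  (forall i x, i \in S -> 0 <= U i x) -> (forall i x, i \in S -> U i x <= L i x) ->
  (forall i, i \in S -> ((1 - alpha)%:E <= wesum (poisson_atom n q0) (U i))%E) ->
  (forall i k, i \in S -> k \in S ->
     (wesum (poisson_atom n q0) (fun x => U i x * U k x)%R <= (G i k)%:E)%E) ->
  \sum_(i in S) \sum_(k in S) G i k <= (1 + alpha) * #|S|%:R ^+ 2 ->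
  ((1 - alpha - b / 2 - 3 * alpha / (2 * b))%:E <= risk eps n q0)%E.
Proof.
move=> S0 b0 alt LR U0 UL EU EUU GS; apply: le_ereal_inf_tmp => _ [phi _ <-].
rewrite poisson_vector_wesum.
apply: (bayes_risk_ge (poisson_atom_ge0 n q0) S0 b0 (wesum_atom1 n q0) U0 EU EUU GS) => i iS.
apply: (@le_trans _ _ (poisson_vector n (q i) (phi @^-1` [set false]))); last first.
  by apply: ereal_sup_ubound; exists (q i) => //; exact: alt.
rewrite poisson_vector_wesum /wesum; apply: le_esum => x _.
rewrite LR// -muleA lee_wpmul2l ?poisson_atom_ge0// -EFinM lee_fin.
rewrite (_ : ~` _ = phi @^-1` [set false]); last first.
  by apply/seteqP; split=> y /=; case: (phi y) => //; case.
by rewrite [leRHS]mulrC ler_wpM2l ?UL// indicE.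
Qed.

End risk_bounds.

(** * Moving mass towards one cell *)

Lemma powR_monomial {R : realType} {p : nat} (r : 'I_p -> R) t x :
  (forall j, 0 < r j) -> monomial r x `^ t = monomial (fun j => r j `^ t) x.
Proof.
move=> r0; rewrite /monomial.
suff [] : 0 <= \prod_(j < p) r j ^+ tnth x j /\
    (\prod_(j < p) r j ^+ tnth x j) `^ t = \prod_(j < p) (r j `^ t) ^+ tnth x j by [].
apply: (big_ind2 (fun a b => 0 <= a /\ a `^ t = b)).
- by rewrite powR1.
- by move=> a _ a' _ [a0 <-] [a'0 <-]; rewrite mulr_ge0// powRM.
move=> j _; rewrite exprn_ge0 ?(ltW (r0 j))//; split=> //.
rewrite -(powR_mulrn _ (ltW (r0 j))) -(powR_mulrn _ (powR_ge0 _ _)).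
by rewrite -!powRrM mulrC.
Qed.

(** A mass [d / n] is added to the cell [i] of [S] and taken back evenly from all the
    cells of [S], whose Poisson means are at least [lam]. Since the total mass is
    unchanged, the likelihood ratio of the perturbed model against the null is the
    bare monomial [monomial (ratio i)], without exponential factor. *)
Section perturbation.
Context {R : realType} {p : nat} (n : R) (q0 : 'rV[R]_p) (S : {set 'I_p}) (lam d : R).
Context (n0 : 0 < n) (sq0 : simplex q0) (lam0 : 0 < lam).
Context (Slam : forall j, j \in S -> lam <= n * q0 0 j) (S1 : (1 < #|S|)%N).
Context (d0 : 0 <= d) (dlam : d < #|S|%:R * lam).

Let N : R := #|S|%:R.

Definition shift (i j : 'I_p) : R := d * ((j == i)%:R - (j \in S)%:R / N).

Definition perturbed i : 'rV[R]_p := \row_j (q0 0 j + shift i j / n).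

Definition ratio i j : R := 1 + shift i j / (n * q0 0 j).

Let N2 : 2 <= N.
Proof. by rewrite ler_nat. Qed.

Let N0 : 0 < N.
Proof. by apply: lt_le_trans N2. Qed.

Let q00 j : 0 <= q0 0 j.
Proof. by have [+ _] := sq0 => /(_ j)/andP[]. Qed.

Let nq0 j : j \in S -> 0 < n * q0 0 j.
Proof. by move=> jS; apply: lt_le_trans (Slam jS). Qed.

Let q0gt0 j : j \in S -> 0 < q0 0 j.
Proof. by move=> /nq0; rewrite pmulr_rgt0. Qed.

Let sum_indicator : \sum_(j < p) (j \in S)%:R = N.
Proof.
rewrite /N -sum1_card natr_sum [RHS]big_mkcond/=.
by apply: eq_bigr => j _; case: ifP.
Qed.

Lemma shift_notin i j : i \in S -> j \notin S -> shift i j = 0.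
Proof.
move=> iS jS; rewrite /shift (negbTE jS) mul0r subr0.
by case: eqP jS => [->|_ _]; rewrite ?iS ?mulr0.
Qed.

Lemma sum_shift i : i \in S -> \sum_j shift i j = 0.
Proof.
move=> iS; rewrite -mulr_sumr sumrB.
rewrite -mulr_suml sum_indicator.
rewrite (bigD1 i)//= eqxx big1 ?addr0; last by move=> j /negbTE ->.
by rewrite divff ?gt_eqF// subrr mulr0.
Qed.

Lemma shift_gt i j : j \in S -> - lam < shift i j.
Proof.
move=> jS; rewrite /shift jS.
apply: (@lt_le_trans _ _ (- (d / N))).
  by rewrite ltrN2 ltr_pdivrMr// mulrC.
rewrite mulrBr mul1r lerDr; apply: mulr_ge0 => //.
Qed.

Lemma ratio_gt0 i j : i \in S -> 0 < ratio i j.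
Proof.
move=> iS; rewrite /ratio; have [jS|jS] := boolP (j \in S); last first.
  by rewrite shift_notin// mul0r addr0.
rewrite -(pmulr_rgt0 _ (nq0 jS)) mulrDr mulr1 [X in _ + X]mulrC divfK ?gt_eqF ?nq0//.
by have := shift_gt i jS; have := Slam jS; lra.
Qed.

Lemma q0_ratio i j : i \in S -> q0 0 j * ratio i j = perturbed i 0 j.
Proof.
move=> iS; rewrite mxE /ratio; have [jS|jS] := boolP (j \in S); last first.
  by rewrite shift_notin// !mul0r !addr0 mulr1.
by rewrite mulrDr mulr1 invfM mulrCA [_^-1 * _^-1]mulrC mulVKf ?gt_eqF ?q0gt0.
Qed.

Lemma nq0_ratio i j : i \in S -> n * q0 0 j * (ratio i j - 1) = shift i j.
Proof.
move=> iS; rewrite mulrBr mulr1 -mulrA q0_ratio// mxE mulrDr addrAC subrr add0r.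
by rewrite mulrC divfK ?gt_eqF.
Qed.

(** The cell [i] moves by [d / n * (1 - #|S|%:R^-1)], at least half of [d / n]
    because [S] has two elements. *)
Lemma perturbed_alternatives i : i \in S -> alternatives q0 (d / (2 * n)) (perturbed i).
Proof.
move=> iS; split.
  have ge0 j : 0 <= perturbed i 0 j.
    by rewrite -q0_ratio// mulr_ge0// ltW// ratio_gt0.
  have sum1 : \sum_j perturbed i 0 j = 1.
    under eq_bigr do rewrite mxE.
    by rewrite big_split/= -mulr_suml sum_shift// mul0r addr0; have [] := sq0.
  split=> // j; rewrite ge0/= -sum1 (bigD1 j)//= lerDl; apply: sumr_ge0 => k _.
  exact: ge0.
apply: (@le_trans _ _ `|(perturbed i - q0) 0 i|); last first.
  rewrite [leRHS]mx_normrE.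
  exact: (@le_bigmax _ _ _ 0 (fun ij : 'I_1 * 'I_p => `|(perturbed i - q0) ij.1 ij.2|) (0, i)).
rewrite !mxE addrAC subrr add0r ger0_norm; last first.
  rewrite divr_ge0 ?(ltW n0)// mulr_ge0// eqxx iS subr_ge0 mul1r invf_le1//.
  by apply: le_trans N2; rewrite ler1n.
rewrite invfM mulrA ler_pM2r ?invr_gt0// ler_wpM2l// eqxx iS mul1r.
have H (u : R) : u <= 2^-1 -> 2^-1 <= 1 - u by lra.
by apply: H; rewrite lef_pV2 ?posrE.
Qed.

Lemma perturbed_atom i x : i \in S ->
  poisson_atom n (perturbed i) x = (poisson_atom n q0 x * (monomial (ratio i) x)%:E)%E.
Proof.
move=> iS; rewrite poisson_atom_tilt ?(ltW n0)//; last first.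
  by move=> j; rewrite ltW// ratio_gt0.
under eq_bigr do rewrite nq0_ratio//.
rewrite sum_shift// expR0 mul1e; congr poisson_atom.
by apply/rowP => j; rewrite [RHS]mxE q0_ratio.
Qed.

(** The exponent is the sum over the cells of the products of shifts divided by the
    Poisson means. Cell by cell only the common target [i = k] and the product of the
    two withdrawals [d / #|S|%:R] contribute positively. *)
Lemma cross_moment_le i k : i \in S -> k \in S ->
  (wesum (poisson_atom n q0) (fun x => monomial (ratio i) x * monomial (ratio k) x)%R
   <= (expR ((i == k)%:R * (d ^+ 2 / lam) + d ^+ 2 / (N * lam)))%:E)%E.
Proof.
move=> iS kS; under [X in wesum _ X]eq_fun do rewrite monomialM.
rewrite wesum_monomial ?(ltW n0)//; last first.
  by move=> j; rewrite mulr_ge0// ltW// ratio_gt0.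
rewrite lee_fin ler_expR.
have E j : n * q0 0 j * (ratio i j * ratio k j - 1) =
    shift i j + shift k j + shift i j * (ratio k j - 1).
  by rewrite -(nq0_ratio j iS) -(nq0_ratio j kS); ring.
under eq_bigr do rewrite E.
rewrite big_split/= big_split/= !sum_shift// !add0r.
apply: (@le_trans _ _ (\sum_j (d ^+ 2 / lam *
    ((j == i)%:R * (j == k)%:R + (j \in S)%:R / N ^+ 2)))).
  apply: ler_sum => j _; have [jS|jS] := boolP (j \in S); last first.
    rewrite shift_notin// mul0r mulr_ge0 ?divr_ge0 ?sqr_ge0 ?(ltW lam0)//.
    by rewrite addr_ge0 ?mulr_ge0// ?invr_ge0// mulr_ge0.
  have -> : shift i j * (ratio k j - 1) = shift i j * shift k j / (n * q0 0 j).
    by rewrite /ratio addrAC subrr add0r mulrA.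
  rewrite ler_pdivrMr ?nq0// /shift jS.
  set a := (j == i)%:R; set b := (j == k)%:R; set u := 1%:R / N.
  have a0 : 0 <= a :> R by rewrite /a.
  have b0 : 0 <= b :> R by rewrite /b.
  have u0 : 0 <= u by rewrite divr_ge0// ltW.
  have -> : 1%:R / N ^+ 2 = u ^+ 2 by rewrite /u expr_div_n expr1n.
  apply: (@le_trans _ _ (d ^+ 2 * (a * b + u ^+ 2))).
    have -> : d * (a - u) * (d * (b - u)) = d ^+ 2 * ((a - u) * (b - u)) by ring.
    by rewrite ler_wpM2l ?sqr_ge0//; nra.
  rewrite [leRHS]mulrAC ler_wpM2r//.
    by apply: addr_ge0; [exact: mulr_ge0|exact: sqr_ge0].
  rewrite -mulrA ler_peMr ?sqr_ge0//.
  by rewrite mulrC ler_pdivlMr// mul1r Slam.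
rewrite -mulr_sumr big_split/= -mulr_suml.
rewrite sum_indicator.
have -> : \sum_(j < p) ((j == i)%:R * (j == k)%:R) = (i == k)%:R :> R.
  by rewrite (bigD1 i)//= eqxx mul1r big1 ?addr0// => j /negbTE ->; rewrite mul0r.
rewrite le_eqVlt; apply/orP; left; apply/eqP; field.
by rewrite !gt_eqF.
Qed.

(** The depleted cells contribute at most a quadratic term. The cell [i] has relative
    increase at most [e * M * lam / (n * q0 0 i)], and [h_scale_le] turns both small
    factors, [e] and the ratio of Poisson means, into factors of [h M]; the
    exponent therefore stays proportional to [e * (lam * h M)] even if [M] is large. *)
Lemma powR_moment_le i t k M e : i \in S -> 0 <= t <= 1 -> 0 < M -> 0 <= e <= 1 ->
  d = e * lam * M -> t * ln (1 + M) <= k ->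
  (wesum (poisson_atom n q0)
     (fun x => monomial (ratio i) x * monomial (ratio i) x `^ t)%R
   <= (expR (t * (9 * expR k * (e * (lam * h M)) + d ^+ 2 / (N * lam))))%:E)%E.
Proof.
move=> iS t01 M0 /andP[e0 e1] dE tk; have [t0 t1] := andP t01.
have r0 j := ratio_gt0 j iS.
under [X in wesum _ X]eq_fun do rewrite powR_monomial// monomialM.
rewrite wesum_monomial ?(ltW n0)//; last first.
  by move=> j; rewrite mulr_ge0 ?powR_ge0// ltW.
rewrite lee_fin ler_expR.
pose excess j := n * q0 0 j * (ratio i j * ratio i j `^ t - 1 - (1 + t) * (ratio i j - 1)).
have E j : n * q0 0 j * (ratio i j * ratio i j `^ t - 1) = excess j + (1 + t) * shift i j.
  by rewrite /excess -(nq0_ratio j iS); ring.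
under eq_bigr do rewrite E.
rewrite big_split/= -mulr_sumr sum_shift// mulr0 addr0.
have hM0 : 0 <= h M by rewrite h_ge0// ltW.
have c0 : 0 <= t * (d ^+ 2 / lam / N ^+ 2).
  by rewrite mulr_ge0// !divr_ge0 ?sqr_ge0// ltW.
have excess_le j : j != i -> excess j <= (j \in S)%:R * (t * (d ^+ 2 / lam / N ^+ 2)).
  move=> ji; rewrite /excess; have [jS|jS] := boolP (j \in S); last first.
    by rewrite /ratio shift_notin// mul0r addr0 powR1 mulr1 !subrr mulr0 subr0 mulr0 mul0r.
  apply: (@le_trans _ _ (n * q0 0 j * (t * (ratio i j - 1) ^+ 2))).
    by rewrite ler_wpM2l ?(ltW (nq0 jS))// moment_excess_le_sqr.
  have -> : n * q0 0 j * (t * (ratio i j - 1) ^+ 2) = t * (shift i j ^+ 2 / (n * q0 0 j)).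
    rewrite -(nq0_ratio j iS); field.
    by rewrite !gt_eqF// q0gt0.
  rewrite [(true)%:R]/(1 : R) mul1r ler_wpM2l// /shift (negbTE ji) jS sub0r mulrN sqrrN.
  rewrite exprMn expr_div_n expr1n mulrAC mul1r.
  by rewrite ler_wpM2r ?invr_ge0 ?sqr_ge0// ler_wpM2l ?sqr_ge0// lef_pV2 ?posrE ?nq0// Slam.
have excess_i : excess i <= t * (9 * expR k * (e * (lam * h M))).
  pose y := ratio i i - 1; have yE : n * q0 0 i * y = d * (1 - N^-1).
    by rewrite nq0_ratio// /shift eqxx iS mul1r.
  have N1 : 0 <= N^-1 <= 1 by rewrite invr_ge0 ltW//= invf_le1// (le_trans _ N2)// ler1n.
  pose a := e * lam * (1 - N^-1) / (n * q0 0 i).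
  have nqi := nq0 iS.
  have aM : a * M = y.
    by rewrite -[y](mulKf (_ : n * q0 0 i != 0)) ?gt_eqF// yE dE /a; ring.
  have a01 : 0 <= a <= 1.
    have [N10 N11] := andP N1.
    rewrite divr_ge0 ?(ltW nqi) ?mulr_ge0// ?subr_ge0// ?(ltW lam0)//=.
    rewrite ler_pdivrMr// mul1r; apply: le_trans (Slam iS).
    rewrite mulrAC ler_piMl ?(ltW lam0)//; apply: mulr_ile1 => //; last by lra.
    by rewrite subr_ge0.
  have y0 : 0 <= y by rewrite -aM mulr_ge0 ?(ltW M0)//; case/andP: a01.
  have yM : y <= M by rewrite -aM ler_piMl ?(ltW M0)//; case/andP: a01.
  have tky : t * ln (1 + y) <= k.
    apply: le_trans tk; rewrite ler_wpM2l// ler_ln ?posrE; lra.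
  have := moment_excess_le_h y0 t01 tky.
  have -> : 1 + y = ratio i i by rewrite /y addrC subrK.
  rewrite /excess -/y => H; apply: (le_trans (ler_wpM2l (ltW nqi) H)).
  have hy : n * q0 0 i * h y <= e * (lam * h M).
    apply: (@le_trans _ _ (n * q0 0 i * (a * h M))).
      by rewrite ler_wpM2l ?(ltW nqi)// -aM h_scale_le ?(ltW M0).
    have -> : n * q0 0 i * (a * h M) = e * (lam * h M) * (1 - N^-1).
      by rewrite /a; field; rewrite !gt_eqF// q0gt0.
    by rewrite ler_piMr// ?mulr_ge0// ?(ltW lam0)//; case/andP: N1; lra.
  have -> : n * q0 0 i * (9 * expR k * t * h y) =
    t * (9 * expR k) * (n * q0 0 i * h y) by ring.
  by rewrite -mulrA ler_wpM2l// ler_wpM2l// mulr_ge0// expR_ge0.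
rewrite (bigD1 i)//= mulrDr lerD//.
apply: (@le_trans _ _ (\sum_(j < p) (j \in S)%:R * (t * (d ^+ 2 / lam / N ^+ 2)))).
  rewrite [leRHS](bigD1 i)//= -[leLHS]add0r.
  by apply: lerD; [exact: mulr_ge0|exact: ler_sum].
rewrite -mulr_suml sum_indicator le_eqVlt; apply/orP; left; apply/eqP; field.
by rewrite !gt_eqF.
Qed.

Lemma wesum_ratio i : i \in S -> wesum (poisson_atom n q0) (monomial (ratio i)) = 1%E.
Proof.
move=> iS; rewrite wesum_monomial ?(ltW n0)//; last by move=> j; rewrite ltW// ratio_gt0.
by under eq_bigr do rewrite nq0_ratio//; rewrite sum_shift// expR0.
Qed.

Let ratio_ge0 i x : i \in S -> 0 <= monomial (ratio i) x.
Proof. by move=> iS; apply: monomial_ge0 => j; rewrite ltW// ratio_gt0. Qed.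

(** When [d ^+ 2 / lam] is small no truncation is needed. *)
Lemma risk_ge_plain alpha b : 0 < b -> 0 <= alpha ->
  expR (d ^+ 2 / lam + d ^+ 2 / (N * lam)) <= 1 + alpha ->
  ((1 - alpha - b / 2 - 3 * alpha / (2 * b))%:E <= risk (d / (2 * n)) n q0)%E.
Proof.
move=> b0 alpha0 H.
apply: (@risk_ge_mixture R p _ S n _ q0 perturbed (fun i => monomial (ratio i))
  (fun i => monomial (ratio i)) (fun _ _ => 1 + alpha)) => //.
- exact: ltnW.
- exact: perturbed_alternatives.
- by move=> i x; exact: perturbed_atom.
- by move=> i iS; rewrite wesum_ratio// lee_fin lerBlDr lerDl.
- move=> i k iS kS; apply: (le_trans (cross_moment_le iS kS)).
  rewrite lee_fin (le_trans _ H)// ler_expR lerD2r ler_piMl//.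
    by rewrite divr_ge0 ?sqr_ge0// ltW.
  by rewrite lern1 leq_b1.
- by rewrite !sumr_const -mulrnA -[leLHS]mulr_natr natrM expr2.
Qed.

(** When [d ^+ 2 / lam] is large, the second moment of a single likelihood ratio is
    too large to be averaged out over [S]. Truncating at [B] bounds it by [B], and the
    truncated mass is controlled by Markov's inequality for the power [t]. *)
Lemma risk_ge_truncated alpha b B t k M e : 0 < b -> 0 < B ->
  0 <= t <= 1 -> 0 < M -> 0 <= e <= 1 -> d = e * lam * M -> t * ln (1 + M) <= k ->
  expR (t * (9 * expR k * (e * (lam * h M)) + d ^+ 2 / (N * lam))) <= alpha * B `^ t ->
  expR (d ^+ 2 / (N * lam)) + B / N <= 1 + alpha ->
  ((1 - alpha - b / 2 - 3 * alpha / (2 * b))%:E <= risk (d / (2 * n)) n q0)%E.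
Proof.
move=> b0 B0 t01 M0 e01 dE tk mom var.
pose L i := monomial (ratio i).
have L0 i x : i \in S -> 0 <= L i x by exact: ratio_ge0.
have Bt0 : 0 < B `^ t by rewrite powR_gt0.
have at0 := poisson_atom_ge0 n q0.
apply: (@risk_ge_mixture R p _ S n _ q0 perturbed L (fun i x => Num.min (L i x) B)
  (fun i k => expR (d ^+ 2 / (N * lam)) + (i == k)%:R * B)) => //.
- exact: ltnW.
- exact: perturbed_alternatives.
- by move=> i x; exact: perturbed_atom.
- by move=> i x iS; rewrite le_min L0// ltW.
- by move=> i x iS; rewrite ge_min lexx.
- move=> i iS.
  have := powR_moment_le iS t01 M0 e01 dE tk; rewrite -/(L i) => momi.
  have LLt0 x : 0 <= L i x * L i x `^ t by rewrite mulr_ge0 ?powR_ge0 ?L0.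
  have U0 x : 0 <= Num.min (L i x) B by rewrite le_min L0// ltW.
  have key : (1 <= wesum (poisson_atom n q0) (fun x => Num.min (L i x) B) + alpha%:E)%E.
    rewrite -(wesum_ratio iS); apply: (@le_trans _ _ (wesum (poisson_atom n q0)
        (fun x => Num.min (L i x) B + (B `^ t)^-1 * (L i x * L i x `^ t)))).
      (* Where [L i x > B], the factor [L i x `^ t / B `^ t] exceeds 1. *)
      apply: le_wesum => // x; rewrite -/(L i); have [LB|BL] := leP (L i x) B.
        by rewrite lerDl mulr_ge0 ?invr_ge0 ?(ltW Bt0).
      rewrite -[leLHS]add0r lerD ?(ltW B0)// mulrCA ler_peMr ?L0//.
      rewrite mulrC ler_pdivlMr// mul1r ge0_ler_powR ?nnegrE ?L0 ?(ltW B0) ?(ltW BL)//.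
      by case/andP: t01.
    rewrite wesumD//; last first.
      by move=> x; rewrite mulr_ge0 ?invr_ge0 ?(ltW Bt0).
    rewrite leeD2l// wesumZ ?invr_ge0 ?(ltW Bt0)//.
    apply: (@le_trans _ _ ((B `^ t)^-1%:E * (alpha * B `^ t)%:E)%E).
      rewrite lee_wpmul2l ?lee_fin ?invr_ge0 ?(ltW Bt0)//.
      by apply: (le_trans momi); rewrite lee_fin.
    by rewrite -EFinM lee_fin mulrC mulfK ?gt_eqF.
  move: key; case: wesum => [r| |]; [|by move=> _; exact: leey|by rewrite addNye].
  by rewrite -EFinD !lee_fin lerBlDr.
- move=> i l iS lS; have [->|il] := eqVneq i l.
    rewrite mul1r; apply: (@le_trans _ _ B%:E); last first.
      by rewrite lee_fin lerDr expR_ge0.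
    apply: (@le_trans _ _ (wesum (poisson_atom n q0) (fun x => B * L l x))).
      apply: le_wesum => // x; rewrite ler_pM ?le_min ?L0 ?(ltW B0)//.
        by rewrite ge_min lexx orbT.
      by rewrite ge_min lexx.
    rewrite wesumZ ?(ltW B0)//; last by move=> x; exact: L0.
    by rewrite wesum_ratio// mule1.
  rewrite mul0r addr0.
  apply: (@le_trans _ _ (wesum (poisson_atom n q0) (fun x => L i x * L l x)%R)).
    apply: le_wesum => // x; rewrite ler_pM ?le_min ?L0 ?(ltW B0)// ge_min lexx//.
  apply: (le_trans (cross_moment_le iS lS)).
  by rewrite (negbTE il) mul0r add0r.
- under eq_bigr => i iS.
    rewrite big_split/= sumr_const -mulr_suml.
    rewrite (bigD1 i)//= eqxx big1 ?addr0; last first.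
      by move=> l /andP[_]; rewrite eq_sym => /negbTE ->.
    over.
  rewrite sumr_const mul1r -[leLHS]mulr_natr -/N expr2 mulrA ler_pM2r//.
  apply: le_trans (ler_wpM2r (ltW N0) var).
  by rewrite expr2 [leRHS]mulrDl divfK ?gt_eqF// [in leRHS]mulr_natr.
Qed.

End perturbation.

(** * The critical radius *)

Section critical_bounds.
Context {R : realType}.
Implicit Types (lam M L x : R).

Lemma expR_le_1D2x x : 0 <= x <= 2^-1 -> expR x <= 1 + 2 * x.
Proof.
move=> /andP[x0 x1]; have e0 := expR_gt0 x.
have := expR_ge1Dx (- x); rewrite expRN -(ler_pM2l e0) divff ?gt_eqF//; nra.
Qed.

Lemma le_expR_id x : x <= expR x.
Proof. by have := expR_ge1Dx x; lra. Qed.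

(** This is where the lower bound on [lam * M] enters: it forces [M] to grow at
    most like the square root of [expR L]. *)
Lemma ln_critical_le lam M L : 0 < lam -> 2 <= lam * M -> lam * h M = L ->
  ln (1 + M) <= 1 + L / 2.
Proof.
move=> lam0 lamM lamh; have M0 : 0 < M by rewrite -(pmulr_rgt0 _ lam0); lra.
apply: (le_trans (ln_le_h_div M0)); rewrite lerD2l.
have L0 : 0 <= L by rewrite -lamh mulr_ge0 ?h_ge0// ltW.
have -> : h M / M = L / (lam * M) by rewrite -lamh; field; rewrite !gt_eqF.
by rewrite ler_wpM2l// lef_pV2 ?posrE//; lra.
Qed.

Lemma sqr_critical_le lam M L : 0 < lam -> 2 <= lam * M -> lam * h M = L ->
  lam * M ^+ 2 <= 8 * expR (1 + L).
Proof.
move=> lam0 lamM lamh; have M0 : 0 < M by rewrite -(pmulr_rgt0 _ lam0); lra.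
have L0 : 0 <= L by rewrite -lamh mulr_ge0 ?h_ge0// ltW.
have M1 : 0 < 1 + M by lra.
have le1 : 1 + M <= expR (1 + L / 2).
  by rewrite -[leLHS]lnK ?posrE// ler_expR (ln_critical_le lam0 lamM).
apply: (@le_trans _ _ (4 * (1 + M) * L)).
  rewrite -lamh [leRHS]mulrCA; apply: ler_wpM2l; first exact: ltW.
  exact: sqr_le_h (ltW M0).
have le2 := le_expR_id (L / 2).
have -> : 8 * expR (1 + L) = 4 * expR (1 + L / 2) * (2 * expR (L / 2)).
  by rewrite mulrACA -expRD; congr (_ * expR _); [ring|field].
by apply: ler_pM => //; [lra|rewrite ler_pM2l|lra].
Qed.

End critical_bounds.

(** All the smallness needed of [c] is packed in the single inequality [cXY]:
    [expR 2] absorbs the constants of the bounds on [M], and [expR K ^+ 3] absorbs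
    both [expR L] when [L <= K] and the factor [K * expR (3 * K / 2)] that comes
    from the moment of order [1 + K / L] otherwise. *)
Section critical_perturbation.
Context {R : realType} {p : nat} (n : R) (q0 : 'rV[R]_p) (S : {set 'I_p}).
Context (alpha K c lam M L : R).
Context (n0 : 0 < n) (sq0 : simplex q0) (S1 : (1 < #|S|)%N) (lam0 : 0 < lam).
Context (Slam : forall j, j \in S -> lam <= n * q0 0 j).
Context (LS : expR (L - 1) <= #|S|%:R) (lamh : lam * h M = L) (lamM : 2 <= lam * M).
Context (alpha0 : 0 < alpha) (alpha1 : alpha <= 1) (K0 : 0 <= K) (c0 : 0 < c).
Context (cXY : c * expR 2 * expR K ^+ 3 <= alpha / 256).

Let N : R := #|S|%:R.
Let d := 2 * c * lam * M.

Let N0 : 0 < N.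
Proof. by rewrite ltr0n ltnW. Qed.

Let M0 : 0 < M.
Proof. by rewrite -(pmulr_rgt0 _ lam0); move: lamM; lra. Qed.

Let X1 : 1 <= expR 2 :> R.
Proof. by rewrite -expR0 ler_expR. Qed.

Let Y1 : 1 <= expR K.
Proof. by rewrite -expR0 ler_expR. Qed.

Let cX : c * expR 2 <= alpha / 256.
Proof.
apply: le_trans cXY; rewrite ler_peMr ?exprn_ege1//.
by rewrite mulr_ge0 ?expR_ge0// ltW.
Qed.

Let cY : c * expR K ^+ 3 <= alpha / 256.
Proof.
apply: le_trans cXY; rewrite ler_wpM2r ?exprn_ge0 ?expR_ge0//.
by rewrite ler_peMr// ltW.
Qed.

Let c1 : c <= 256^-1.
Proof.
apply: (@le_trans _ _ (c * expR 2)); first by rewrite ler_peMr// ltW.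
by apply: (le_trans cX); move: alpha1; lra.
Qed.

Let expR1DL : expR (1 + L) = expR 2 * expR (L - 1).
Proof. by rewrite -expRD; congr expR; lra. Qed.

Let MN : M <= expR 2 * N.
Proof.
have M1 : 0 < 1 + M by rewrite addr_gt0.
have le1 : 1 + M <= expR (1 + L).
  rewrite -[leLHS]lnK ?posrE// ler_expR.
  apply: (le_trans (ln_critical_le lam0 lamM lamh)); rewrite lerD2l.
  suff : 0 <= L by lra.
  by rewrite -lamh mulr_ge0 ?h_ge0// ltW.
have : expR 2 * expR (L - 1) <= expR 2 * N by rewrite ler_wpM2l ?expR_ge0.
by rewrite -expR1DL; move: le1; lra.
Qed.

Let d0 : 0 <= d.
Proof. by rewrite !mulr_ge0 ?(ltW c0) ?(ltW lam0) ?(ltW M0). Qed.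

Let dlam : d < N * lam.
Proof.
rewrite /d -mulrA [lam * M]mulrC mulrA ltr_pM2r//.
apply: (@le_lt_trans _ _ (2 * c * (expR 2 * N))).
  by rewrite ler_wpM2l ?mulr_ge0// ltW.
rewrite mulrA -[ltRHS]mul1r ltr_pM2r//.
by move: cX alpha1; lra.
Qed.

Let sqr_d_le : d ^+ 2 / lam <= 32 * c * (c * expR 2) * expR (L - 1).
Proof.
have -> : d ^+ 2 / lam = 4 * c ^+ 2 * (lam * M ^+ 2) by rewrite /d; field; rewrite gt_eqF.
have := sqr_critical_le lam0 lamM lamh; rewrite expR1DL => H.
have -> : 32 * c * (c * expR 2) * expR (L - 1) =
  4 * c ^+ 2 * (8 * (expR 2 * expR (L - 1))) by ring.
by rewrite ler_wpM2l// mulr_ge0// sqr_ge0.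
Qed.

Let c32 u : c * u <= alpha / 256 -> 32 * c * (c * u) <= alpha / 8.
Proof.
move=> cu; apply: (@le_trans _ _ (32 * c * (alpha / 256))).
  by rewrite ler_wpM2l// mulr_ge0// ltW.
have := ler_wpM2r (ltW alpha0) c1; move: alpha0; lra.
Qed.

Let sqr_d_divN_le : d ^+ 2 / (N * lam) <= alpha / 8.
Proof.
have -> : d ^+ 2 / (N * lam) = d ^+ 2 / lam / N by field; rewrite !gt_eqF.
rewrite ler_pdivrMr//; apply: (le_trans sqr_d_le).
apply: (@le_trans _ _ (32 * c * (c * expR 2) * N)).
  by rewrite ler_wpM2l// !mulr_ge0 ?expR_ge0// ltW.
by rewrite ler_pM2r// c32.
Qed.

Lemma critical_risk_ge_plain (b : R) : 0 < b -> L <= K ->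
  ((1 - alpha - b / 2 - 3 * alpha / (2 * b))%:E <= risk (d / (2 * n)) n q0)%E.
Proof.
move=> b0 LK.
apply: (risk_ge_plain n0 sq0 lam0 Slam S1 d0 dlam b0 (ltW alpha0)); rewrite -/N.
have small : d ^+ 2 / lam <= alpha / 8.
  apply: (le_trans sqr_d_le).
  have eLY : expR (L - 1) <= expR K ^+ 3.
    apply: (@le_trans _ _ (expR K)); first by rewrite ler_expR; move: LK; lra.
    by rewrite -[leLHS]expr1 ler_weXn2l.
  apply: (@le_trans _ _ (32 * c * (c * expR 2 * expR K ^+ 3))).
    rewrite -[32 * c * (c * _) * _]mulrA ler_wpM2l ?mulr_ge0 ?(ltW c0)//.
    by rewrite ler_wpM2l// mulr_ge0 ?expR_ge0// ltW.
  by rewrite -[c * _ * _]mulrA c32// mulrA.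
apply: (@le_trans _ _ (expR (alpha / 4))).
  by rewrite ler_expR; move: small sqr_d_divN_le; lra.
by apply: (le_trans (expR_le_1D2x _)); move: alpha0 alpha1; lra.
Qed.

(** The truncation level [expR (L / 2)] is at most of the order of the square root of
    [#|S|%:R], so the diagonal terms average out. The power [t = K / L] makes the
    factor gained on the truncated mass equal to [expR (- (K / 2))], while
    [t * ln (1 + M)] stays bounded by [ln_critical_le]. *)
Lemma critical_risk_ge_truncated (b : R) : 0 < b -> 1 <= L -> K < L ->
  expR (1 - K / 2) = alpha / 2 ->
  ((1 - alpha - b / 2 - 3 * alpha / (2 * b))%:E <= risk (d / (2 * n)) n q0)%E.
Proof.
move=> b0 L1 KL eK; have L0 : 0 < L by apply: lt_le_trans L1.
have t0 : 0 <= K / L by rewrite divr_ge0// ltW.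
have t1 : K / L <= 1 by rewrite ler_pdivrMr// mul1r ltW.
have tL : K / L * L = K by rewrite divfK// gt_eqF.
have e01 : 0 <= 2 * c <= 1 by move: c0 c1; lra.
have tk : K / L * ln (1 + M) <= 3 * K / 2.
  apply: (le_trans (ler_wpM2l t0 (ln_critical_le lam0 lamM lamh))).
  have : K / L <= K by rewrite ler_pdivrMr// ler_peMr.
  by rewrite mulrDr mulr1 mulrA tL; lra.
apply: (@risk_ge_truncated _ _ _ _ _ _ _ n0 sq0 lam0 Slam S1 d0 dlam _ _ (expR (L / 2))
  (K / L) _ _ _ b0 (expR_gt0 _) _ M0 e01 erefl tk); rewrite -/N ?t0//.
  rewrite lamh -expRM.
  have -> : L / 2 * (K / L) = K / 2 by field; rewrite gt_eqF.
  apply: (@le_trans _ _ (expR 1)); last first.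
    have -> : (1 : R) = (1 - K / 2) + K / 2 by rewrite subrK.
    by rewrite expRD subrK eK ler_pM2r ?expR_gt0//; move: alpha0; lra.
  rewrite ler_expR mulrDr.
  have -> : K / L * (9 * expR (3 * K / 2) * (2 * c * L)) =
     18 * c * (K / L * L * expR (3 * K / 2)) by ring.
  rewrite tL.
  have KY : K * expR (3 * K / 2) <= expR K ^+ 3.
    rewrite exprS ler_pM ?expR_ge0 ?le_expR_id//.
    by rewrite -expRM_natl ler_expR mulr_natl; move: K0; lra.
  have tD : K / L * (d ^+ 2 / (N * lam)) <= 1 * (alpha / 8).
    by rewrite ler_pM// divr_ge0 ?sqr_ge0// mulr_ge0// ltW.
  have := ler_wpM2l (ltW c0) KY.
  by move: tD cY alpha1; set Z := K * _; set D := K / L * _; lra.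
have vD : expR (d ^+ 2 / (N * lam)) <= 1 + alpha / 4.
  apply: (@le_trans _ _ (expR (alpha / 8))); first by rewrite ler_expR.
  by apply: (le_trans (expR_le_1D2x _)); move: alpha0 alpha1; lra.
have vB : expR (L / 2) / N <= alpha / 2.
  rewrite ler_pdivrMr// -eK.
  apply: (@le_trans _ _ (expR (1 - K / 2) * expR (L - 1))).
    by rewrite -expRD ler_expR; move: KL; lra.
  by rewrite ler_wpM2l// expR_ge0.
by move: vD vB alpha0; lra.
Qed.

End critical_perturbation.

(** [K] is chosen so that [expR (1 - K / 2) = alpha / 2], and [alpha] so that the loss
    in [risk_ge_mixture] with [b = 1 - eta] is at most [1 - eta]. *)
Lemma critical_risk_ge {R : realType} (p : nat) (n : R) (q0 : 'rV[R]_p) (S : {set 'I_p})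
    (eta alpha K c lam M L : R) :
  0 < eta < 1 -> alpha = (1 - eta) ^+ 2 / 8 -> K = 2 * (1 - ln (alpha / 2)) ->
  0 < n -> simplex q0 -> (1 < #|S|)%N -> 0 < lam ->
  (forall j, j \in S -> lam <= n * q0 0 j) ->
  1 <= L -> expR (L - 1) <= #|S|%:R -> lam * h M = L -> 2 <= lam * M ->
  0 < c < alpha * expR (- (3 * K + 2)) / 256 ->
  (eta%:E <= risk (c * (lam * M) / n) n q0)%E.
Proof.
move=> /andP[eta0 eta1] alphaE KE n0 sq0 S1 lam0 Slam L1 LS lamh lamM /andP[c0 cle].
have b0 : 0 < 1 - eta by rewrite subr_gt0.
have alpha0 : 0 < alpha by rewrite alphaE divr_gt0 ?exprn_gt0.
have alpha1 : alpha <= 1 by rewrite alphaE; move: eta0 eta1; nra.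
have eK : expR (1 - K / 2) = alpha / 2.
  rewrite KE (_ : 1 - _ / 2 = ln (alpha / 2)); last by field.
  by rewrite lnK// posrE divr_gt0.
have K0 : 0 <= K.
  have : ln (alpha / 2) <= 0 by apply: ln_le0; move: alpha1; lra.
  by rewrite KE; lra.
have cXY : c * expR 2 * expR K ^+ 3 <= alpha / 256.
  have e0 : 0 < expR (- (3 * K + 2)) by rewrite expR_gt0.
  rewrite -(ler_pM2r e0) -expRM_natl -2![c * _ * _ in leLHS]mulrA -!expRD.
  rewrite [2 + _]addrC subrr.
  by rewrite expR0 mulr1 mulrAC ltW.
have -> : c * (lam * M) / n = 2 * c * lam * M / (2 * n) by field; rewrite gt_eqF.
apply: (@le_trans _ _ (1 - alpha - (1 - eta) / 2 - 3 * alpha / (2 * (1 - eta)))%:E).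
  rewrite lee_fin (_ : 3 * alpha / _ = 3 * (1 - eta) / 16); last first.
    by rewrite alphaE; field; rewrite gt_eqF.
  by rewrite alphaE; move: eta0 eta1; nra.
have [LK|KL] := leP L K.
  exact: (critical_risk_ge_plain n0 sq0 S1 lam0 Slam LS lamh lamM alpha0 alpha1 K0 c0 cXY b0 LK).
exact: (critical_risk_ge_truncated n0 sq0 S1 lam0 Slam LS lamh lamM alpha0 alpha1 K0 c0 cXY b0).
Qed.

Unset Implicit Arguments.

Theorem theorem5 (R : realType) :
  exists2 Cstar : R, 0 < Cstar &
  forall eta : R, 0 < eta < 1 ->
  exists Ceta ceta : R, [/\ expR 1 <= Ceta, 0 < ceta &
    forall (p : nat) (n : R) (q0 : 'rV[R]_p),
      (2 <= p)%N -> 0 < n -> simplex q0 ->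
      (forall i j : 'I_p, (i <= j)%N -> q0 0 j <= q0 0 i) ->
      \big[Num.max/0]_(1 <= j < p)
        (dropmax q0 j * hinv (ln (expR 1 * j%:R) / (n * dropmax q0 j)))
        >= Cstar / n ->
      forall jstar : nat, is_jstar n q0 jstar ->
      forall c : R, 0 < c < ceta ->
        (eta%:E <= risk (c * psi n q0 Ceta jstar / n) n q0)%E].
Proof.
exists 2 => // eta eta01.
pose alpha : R := (1 - eta) ^+ 2 / 8.
pose K : R := 2 * (1 - ln (alpha / 2)).
exists (expR 1), (alpha * expR (- (3 * K + 2)) / 256); split=> //.
  have [_ eta1] := andP eta01.
  by rewrite !divr_gt0 ?mulr_gt0 ?expR_gt0 ?invr_gt0 ?exprn_gt0 ?subr_gt0.
move=> p n q0 _ n0 sq0 mono big J [/andP[J1 Jp] Jmax] c cc.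
(* When the indicator in [psi] vanishes, so does the radius. *)
rewrite /psi; have [_|_] := boolP (1 <= mstar n q0 J); last first.
  rewrite !mulr0 mul0r; apply: le_trans (risk0_ge1 n sq0).
  by rewrite lee_fin ltW//; case/andP: eta01.
rewrite mulr1.
have rad2 : 2 <= Defs.radius n q0 (expR 1) J.
  rewrite leNgt; apply/negP => r2; move: big; rewrite leNgt => /negP; apply.
  rewrite big_nat; apply: bigmax_lt => [|i ip]; first by rewrite divr_gt0.
  rewrite ltr_pdivlMr// mulrC mulrA.
  exact: le_lt_trans (Jmax i ip) r2.
rewrite /Defs.radius /= in rad2 *.
set lam := n * dropmax q0 J in rad2 *; set L := ln _ in rad2 *.
have lamE : lam = n * q0 0 (Ordinal Jp) by rewrite /lam /dropmax insubT.
have lam0 : 0 < lam.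
  have [/(_ (Ordinal Jp))/andP[q00 _] _] := sq0.
  have lamge : 0 <= lam by rewrite lamE mulr_ge0 ?(ltW n0).
  rewrite lt_neqAle lamge andbT eq_sym.
  by apply/eqP => l0; move: rad2; rewrite l0 mul0r; lra.
have J0 : 0 < J%:R :> R by rewrite ltr0n.
have LE : L = 1 + ln J%:R by rewrite /L lnM ?posrE ?expR_gt0// expRK.
have L1 : 1 <= L by rewrite LE lerDl ln_ge0// ler1n.
(* The cell 0 is included, so that [S] has two elements even for [J = 1]. *)
pose S : {set 'I_p} := [set widen_ord Jp i | i : 'I_J.+1]%SET.
have cS : #|S| = J.+1.
  by rewrite card_imset ?card_ord// => i j /(congr1 val)/= /val_inj.
apply: (@critical_risk_ge R p n q0 S eta alpha K c lam _ L) => //.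
- by rewrite cS.
- move=> j /imsetP[i _ ->]; rewrite lamE ler_pM2l//.
  by apply: mono => /=; rewrite -ltnS.
- by rewrite LE addrC addKr lnK ?posrE// cS ler_nat.
- have y0 : 0 <= L / lam by apply: divr_ge0; [lra|exact: ltW].
  by rewrite (hinvK y0) [LHS]mulrC divfK// gt_eqF.
Qed.
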